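(* Let $\alpha>0$ and let $c=\alpha n$. Let $\varepsilon>0$ be a sufficiently small constant and let $p=\frac{1+\varepsilon}{n}$. Then with high probability $G_c(n,p)$ contains a rainbow tree of order at least $\left(\frac{\alpha}{\alpha+1}\varepsilon-O\left(\varepsilon^2\right)\right)n$. That is, for every $\alpha>0$ there exist constants $\varepsilon_0,C>0$ such that for every constant $0<\varepsilon<\varepsilon_0$, with high probability $G_{\alpha n}\left(n,\frac{1+\varepsilon}{n}\right)$ contains a rainbow tree of order at least $\left(\frac{\alpha}{\alpha+1}\varepsilon-C\varepsilon^2\right)n$.
   Context: For $c,n\in\mathbb{N}$ and $p\in(0,1)$, $G_c(n,p)$ is the random edge-coloured graph obtained by taking the Erdős–Rényi binomial random graph $G(n,p)$ on $n$ vertices and assigning to each edge a colour chosen independently and uniformly at random from a set of $c$ colours. A subgraph is rainbow if all of its edges receive different colours. The order of a tree is its number of vertices. ''With high probability'' means with probability tending to $1$ as $n\to\infty$. Floors and ceilings are ignored where they do not significantly affect the argument (so $c=\alpha n$ is understood up to rounding to an integer). *)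

(* Defs.v *)
From mathcomp Require Import all_boot all_order all_algebra.
From mathcomp Require Import all_classical all_reals all_analysis.

Set Implicit Arguments.
Unset Strict Implicit.
Unset Printing Implicit Defensive.

Import Order.TTheory GRing.Theory Num.Theory.
Import numFieldNormedType.Exports.

Local Open Scope ring_scope.

(* The potential edges of a simple graph on 'I_n. *)
Definition edge (n : nat) : finType := {e : {set 'I_n} | #|e| == 2%N}.

(* A simple graph on 'I_n with edges coloured by 'I_c: [H e = None] when e is
   not an edge of H, and [H e = Some k] when e is an edge of H of colour k. *)
Definition cgraph (n c : nat) : finType := {ffun edge n -> option 'I_c}.

Definition edges (n c : nat) (H : cgraph n c) : {set edge n} :=
  finset (fun e => isSome (H e)).

(* The probability that G(n, p) has edge set E. *)
Definition gnp_mass (R : realType) (n : nat) (p : R) (E : {set edge n}) : R :=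
  p ^+ #|E| * (1 - p) ^+ #|(~: E)%SET|.

(* The probability that G_c(n, p) is H. Given its edge set E, each of the
   c ^ #|E| colourings of E is equally likely. *)
Definition gcnp_mass (R : realType) (n c : nat) (p : R) (H : cgraph n c) : R :=
  gnp_mass p (edges H) * (c%:R ^+ #|edges H|)^-1.

(* The probability that G_c(n, p) belongs to A. The formula is a probability
   only for 0 <= p <= 1 and 0 < c. *)
Definition gcnp_prob (R : realType) (n c : nat) (p : R)
    (A : set (cgraph n c)) : R :=
  \sum_(H : cgraph n c | H \in A) gcnp_mass p H.

Definition adj (n : nat) (F : {set edge n}) : rel 'I_n :=
  fun x y => [exists e in F, val e == [set x; y]%SET].

Definition is_graph (n : nat) (V : {set 'I_n}) (F : {set edge n}) : Prop :=
  forall e : edge n, e \in F -> val e \subset V.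

Definition is_connected (n : nat) (V : {set 'I_n}) (F : {set edge n}) : Prop :=
  (0 < #|V|)%N /\ {in V &, forall x y : 'I_n, connect (adj F) x y}.

Definition is_acyclic (n : nat) (F : {set edge n}) : Prop :=
  forall s : seq 'I_n, (2 < size s)%N -> uniq s -> ~~ cycle (adj F) s.

Definition is_tree (n : nat) (V : {set 'I_n}) (F : {set edge n}) : Prop :=
  [/\ is_graph V F, is_connected V F & is_acyclic F].

(* As F consists of edges of H, injectivity of H on F is injectivity of the
   colouring on F. *)
Definition is_rainbow_in (n c : nat) (H : cgraph n c) (F : {set edge n}) : Prop :=
  F \subset edges H /\ {in F &, injective H}.

Definition has_rainbow_tree (R : realType) (n c : nat) (m : R)
    (H : cgraph n c) : Prop :=
  exists (V : {set 'I_n}) (F : {set edge n}),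
    [/\ is_tree V F, is_rainbow_in H F & m <= #|V|%:R].

Lemma gcnp_prob_setT (R : realType) (n c : nat) (p : R) :
  (0 < c)%N -> gcnp_prob p (@setT (cgraph n c)) = 1.
Proof.
move=> c0; rewrite /gcnp_prob.
pose f (o : option 'I_c) : R := if o is Some _ then p / c%:R else 1 - p.
transitivity (\sum_(H : {ffun edge n -> option 'I_c}) \prod_e f (H e)).
  apply: eq_big => [H|H _]; first exact: mem_set.
  rewrite (bigID (mem (edges H))) /= /gcnp_mass /gnp_mass.
  have -> : \prod_(e in edges H) f (H e) = (p / c%:R) ^+ #|edges H|.
    rewrite -prodr_const; apply: eq_bigr => e.
    by rewrite finset.in_set; case: (H e).
  have -> : \prod_(e | e \notin edges H) f (H e) =
            (1 - p) ^+ #|(~: edges H)%SET|.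
    rewrite -prodr_const; apply: eq_big => [e|e]; first by rewrite finset.in_setC.
    by rewrite finset.in_set; case: (H e).
  by rewrite exprMn exprVn mulrAC.
rewrite -(bigA_distr_bigA (fun _ : edge n => f)) /=.
apply: big1 => e _; rewrite (bigD1 None) //=.
rewrite (reindex_omap Some id) /=; last by case.
rewrite (eq_bigl xpredT) => [|i]; last by rewrite eqxx.
rewrite sumr_const card_ord -[X in _ + X]mulr_natr mulfVK ?subrK //.
by rewrite pnatr_eq0 -lt0n.
Qed.

(* Main.v *)
Require Import Defs.
From mathcomp Require Import all_boot all_order all_algebra.
From mathcomp Require Import all_classical all_reals all_analysis.
From mathcomp Require Import lra ring zify.

Set Implicit Arguments.
Unset Strict Implicit.
Unset Printing Implicit Defensive.

Import Order.TTheory GRing.Theory Num.Theory.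
Import numFieldNormedType.Exports.

Local Open Scope ring_scope.

(** Grow a rainbow tree greedily. Starting from a root, explore the vertices of
    the tree one at a time: when [v] is explored, the pairs joining it to the
    vertices not seen so far are queried, and the far end of an edge joins the
    tree exactly when its colour is not yet used there. If [t] vertices have been
    seen, a vertex has about
      (1 + eps) (1 - t / n) (1 - t / (alpha n))
        ~ 1 + eps - (t / n) (alpha + 1) / alpha
    children on average, and this stays above 1 as long as [t / n] is below
    [alpha / (alpha + 1) * eps]. With the target size lowered by [2 eps^2 n], the
    mean is at least [1 + eps^2 / 2] until the target is reached
    ([offspring_mean]). A tree that dies out is discarded with its vertices, and
    a new root is taken among the unseen vertices; all pairs of unseen vertices
    are still unqueried. As the mean number of children exceeds 1 throughout, it
    is exponentially unlikely that the vertices seen do not outnumber the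
    vertices explored once [K], a small multiple of [n], of them have been
    explored. So the tree that is alive at that time never dies, and it reaches
    the target, because the dead trees used only [K] vertices.

    The exploration itself is never defined. What has been queried is recorded as
    a partial assignment of outcomes to pairs, and [fail_prob] is the conditional
    probability that there is no large rainbow tree. Resampling one coordinate of
    the product measure ([gcnp_prob_recolour]) shows that this quantity is the
    average of its values after one more query ([fail_prob_query]). The heart of
    the proof is [explore_fail_prob], an induction that bounds it by a
    supermartingale
      z ^ (active vertices) * rho ^ (explorations missing to K)
        * theta ^ (pairs left to query at the current vertex),
    where [theta = 1 - q (1 - z)] and [q] bounds below the chance that a query
    enlarges the tree. It equals [rho ^ K] initially, it is at least 1 if the
    tree dies after [K] explorations, and it does not increase when the next
    vertex is taken provided that [theta ^ x <= rho * z], [x] being the number of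
    unseen vertices. For suitable [z, rho < 1] this is what a mean of at least
    [1 + delta] gives ([survival_rate]). *)

(** * Trees *)

Lemma adj_sym (n : nat) (F : {set edge n}) : symmetric (adj F).
Proof. by move=> x y; rewrite /adj (finset.setUC [set x]%SET). Qed.

Lemma edge_of_pair (n : nat) (x y : 'I_n) :
  x != y -> exists e : edge n, val e = [set x; y]%SET.
Proof.
move=> xy; have h : #|[set x; y]%SET| == 2%N by rewrite cards2 xy.
by exists (exist (fun e : {set 'I_n} => #|e| == 2%N) _ h).
Qed.

Lemma is_tree1 (n : nat) (r : 'I_n) :
  is_tree [set r]%SET (finset.set0 : {set edge n}).
Proof.
split.
- by move=> e; rewrite finset.in_set0.
- split; first by rewrite cards1.
  by move=> x y /finset.set1P-> /finset.set1P->; exact: connect0.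
- move=> [|x [|y s]] //= _ _; apply/negP => /andP[/existsP[e]].
  by rewrite finset.in_set0.
Qed.

(** A cycle through [y] would have to enter and leave [y] through its only
    neighbour [v], so it would visit [v] twice. *)
Lemma is_tree_leaf (n : nat) (V : {set 'I_n}) (F : {set edge n})
    (v y : 'I_n) (e : edge n) :
  is_tree V F -> v \in V -> y \notin V -> val e = [set v; y]%SET ->
  is_tree (y |: V)%SET (e |: F)%SET.
Proof.
move=> [grF [V0 conF] acF] vV yV ve.
have vy : v != y by apply: contraNneq yV => <-.
have adjL a : adj (e |: F) y a -> a = v.
  move=> /existsP[e' /andP[/setU1P[->|e'F] /eqP]].
    rewrite ve => E; have : v \in [set y; a]%SET by rewrite -E finset.set21.
    by case/finset.set2P => [/eqP|->//]; rewrite (negbTE vy).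
  move=> E; have := grF _ e'F; rewrite E => /fintype.subsetP/(_ y).
  by rewrite finset.set21 (negbTE yV) => /(_ isT).
split.
- move=> e' /setU1P[->|/grF h]; last first.
    exact: fintype.subset_trans h (finset.subsetUr _ _).
  rewrite ve; apply/fintype.subsetP => x /finset.set2P[]->;
    by rewrite !inE ?vV ?eqxx ?orbT.
- have sub : subrel (connect (adj F)) (connect (adj (e |: F)%SET)).
    apply: connect_sub => a b /existsP[e' /andP[e'F E]]; apply: connect1.
    by apply/existsP; exists e'; rewrite E finset.in_setU e'F orbT.
  have csym := sym_connect_sym (@adj_sym n (e |: F)%SET).
  have vx x : x \in (y |: V)%SET -> connect (adj (e |: F)%SET) v x.
    case/setU1P => [->|xV]; last exact/sub/conF.
    by apply: connect1; apply/existsP; exists e; rewrite setU11 ve eqxx.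
  split; first by apply/card_gt0P; exists y; rewrite setU11.
  move=> x x' hx hx'; apply: connect_trans (vx _ hx').
  by rewrite csym vx.
- move=> s s2 us; apply/negP => cs.
  have [ys|ys] := boolP (y \in s).
    have [i p E] := rot_to ys.
    move: cs us s2; rewrite -(rot_cycle i) -(rot_uniq i) -(size_rot i s) E.
    case: p {E} => [|a p] //= /andP[/adjL ->]; rewrite rcons_path => /andP[_].
    rewrite adj_sym => /adjL lv /andP[_ /andP[vp _]].
    case/lastP: p lv vp => [|p b] //; rewrite last_rcons => ->.
    by rewrite mem_rcons mem_head.
  apply: (negP (acF _ s2 us)); move: cs.
  apply: (@sub_in_cycle _ (predC1 y) (adj (e |: F)%SET)).
    move=> a b /= ay yb /existsP[e' /andP[/setU1P[->|e'F] E]]; last first.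
      by apply/existsP; exists e'; rewrite e'F.
    have : y \in val e by rewrite ve finset.set22.
    by rewrite (eqP E) => /finset.set2P[] yE; move: ay yb; rewrite !inE yE eqxx.
  by apply/allP => x xs; apply: contraNneq ys => <-.
Qed.

(** * The product measure *)

Definition pair_mass (R : realType) (c : nat) (p : R) (o : option 'I_c) : R :=
  if o is Some _ then p / c%:R else 1 - p.

Lemma pair_mass_ge0 (R : realType) (c : nat) (p : R) (o : option 'I_c) :
  0 <= p -> p <= 1 -> 0 <= pair_mass p o.
Proof. by move=> p0 p1; case: o => [k|] /=; rewrite ?divr_ge0 ?subr_ge0. Qed.

Lemma sum_option (R : realType) (c : nat) (g : option 'I_c -> R) :
  \sum_o g o = g None + \sum_k g (Some k).
Proof.
rewrite (bigD1 None) //= (reindex_omap Some id) /=; last by case.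
by congr (_ + _); apply: eq_bigl => k; rewrite eqxx.
Qed.

Lemma sum_pair_mass (R : realType) (c : nat) (p : R) :
  (0 < c)%N -> \sum_(o : option 'I_c) pair_mass p o = 1.
Proof.
move=> c0; rewrite sum_option /= sumr_const card_ord.
by rewrite -[X in _ + X]mulr_natr mulfVK ?subrK // pnatr_eq0 -lt0n.
Qed.

(** The model is a product measure: the pairs are independent, each with outcome
    distribution [pair_mass p]. *)
Lemma gcnp_mass_prod (R : realType) (n c : nat) (p : R) (H : cgraph n c) :
  gcnp_mass p H = \prod_e pair_mass p (H e).
Proof.
rewrite (bigID (mem (edges H))) /= /gcnp_mass /gnp_mass.
have -> : \prod_(e in edges H) pair_mass p (H e) = (p / c%:R) ^+ #|edges H|.
  rewrite -prodr_const; apply: eq_bigr => e.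
  by rewrite finset.in_set; case: (H e).
have -> : \prod_(e | e \notin edges H) pair_mass p (H e) =
          (1 - p) ^+ #|(~: edges H)%SET|.
  rewrite -prodr_const; apply: eq_big => [e|e]; first by rewrite finset.in_setC.
  by rewrite finset.in_set; case: (H e).
by rewrite exprMn exprVn mulrAC.
Qed.

Lemma gcnp_mass_ge0 (R : realType) (n c : nat) (p : R) (H : cgraph n c) :
  0 <= p -> p <= 1 -> 0 <= gcnp_mass p H.
Proof.
by move=> p0 p1; rewrite gcnp_mass_prod; apply: prodr_ge0 => e _;
  exact: pair_mass_ge0.
Qed.

Lemma gcnp_prob_setC (R : realType) (n c : nat) (p : R) (A : set (cgraph n c)) :
  (0 < c)%N -> gcnp_prob p A = 1 - gcnp_prob p (~` A)%classic.
Proof.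
move=> c0; rewrite -(gcnp_prob_setT n p c0) /gcnp_prob [in RHS](bigID (mem A)) /=.
rewrite [X in _ + X - _](eq_bigl (fun H => H \in (~` A)%classic)); last first.
  by move=> H; rewrite in_setC in_setT.
by rewrite addrK; apply: eq_bigl => H; rewrite in_setT.
Qed.

Lemma gcnp_prob_le1 (R : realType) (n c : nat) (p : R) (A : set (cgraph n c)) :
  (0 < c)%N -> 0 <= p -> p <= 1 -> gcnp_prob p A <= 1.
Proof.
move=> c0 p0 p1; rewrite gcnp_prob_setC // gerBl; apply: sumr_ge0 => H _.
exact: gcnp_mass_ge0.
Qed.

Definition recolour (n c : nat) (H : cgraph n c) (e : edge n)
    (o : option 'I_c) : cgraph n c :=
  [ffun e' => if e' == e then o else H e'].

(** Resampling the outcome of [e] preserves the measure. The proof is the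
    involution that swaps the fresh outcome with the one of [H] at [e]; it
    preserves the product of their masses. *)
Lemma gcnp_prob_recolour (R : realType) (n c : nat) (p : R) (e : edge n)
    (A : set (cgraph n c)) : (0 < c)%N ->
  gcnp_prob p A =
  \sum_o pair_mass p o * gcnp_prob p [set H | A (recolour H e o)]%classic.
Proof.
move=> c0; pose g (x : option 'I_c * cgraph n c) : R :=
  pair_mass p x.1 * (if x.2 \in A then gcnp_mass p x.2 else 0).
pose swap (x : option 'I_c * cgraph n c) := (x.2 e, recolour x.2 e x.1).
have swapK : involutive swap.
  case=> o H; rewrite /swap /= ffunE eqxx; congr (_, _).
  by apply/ffunP => e'; rewrite !ffunE; case: eqP => // ->.
transitivity (\sum_x g x).
  rewrite -(pair_bigA _ (fun o H => g (o, H))) /g /=.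
  under eq_bigr do rewrite -mulr_sumr /=.
  by rewrite -mulr_suml sum_pair_mass // mul1r /gcnp_prob big_mkcond.
rewrite (reindex_inj (inv_inj swapK)) /=.
rewrite -(pair_bigA _ (fun o H => g (swap (o, H)))) /=.
apply: eq_bigr => o _; rewrite /gcnp_prob [in RHS]big_mkcond mulr_sumr.
apply: eq_bigr => H _; rewrite /g /=.
have -> : (H \in [set H0 | A (recolour H0 e o)]%classic) = (recolour H e o \in A).
  by apply/idP/idP => /set_mem h; exact: mem_set.
case: ifP => _; last by rewrite !mulr0.
rewrite !gcnp_mass_prod (bigD1 e) //= [in RHS](bigD1 e) //= ffunE eqxx mulrCA.
congr (_ * (_ * _)); apply: eq_bigr => e' /negPf ne.
by rewrite ffunE ne.
Qed.

(** * Conditioning on queried pairs *)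

(** [None] stands for a pair not yet queried, [Some o] for a pair found to have
    the outcome [o]. *)
Definition answers (n c : nat) := edge n -> option (option 'I_c).

Definition no_answers (n c : nat) : answers n c := fun=> None.

Definition add_answer (n c : nat) (s : answers n c) (e : edge n)
    (o : option 'I_c) : answers n c :=
  fun e' => if e' == e then Some o else s e'.

Definition complete (n c : nat) (s : answers n c) (H : cgraph n c) : cgraph n c :=
  [ffun e => odflt (H e) (s e)].

(** By independence of the pairs, this is the probability of failure conditional
    on the answers [s]. *)
Definition fail_prob (R : realType) (n c : nat) (p m : R) (s : answers n c) : R :=
  gcnp_prob p [set H | ~ has_rainbow_tree m (complete s H)]%classic.

Lemma fail_prob_query (R : realType) (n c : nat) (p m : R) (s : answers n c)
    (e : edge n) : (0 < c)%N -> s e = None ->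
  fail_prob p m s = \sum_o pair_mass p o * fail_prob p m (add_answer s e o).
Proof.
move=> c0 se; rewrite /fail_prob (gcnp_prob_recolour p e) //.
apply: eq_bigr => o _; congr (_ * gcnp_prob _ _).
apply/funext => H /=; congr (~ has_rainbow_tree _ _).
by apply/ffunP => e'; rewrite !ffunE /add_answer; case: eqP => // ->; rewrite se.
Qed.

Lemma fail_prob_found (R : realType) (n c : nat) (p m : R) (s : answers n c)
    (V : {set 'I_n}) (F : {set edge n}) :
  is_tree V F -> {in F, forall e, exists k, s e = Some (Some k)} ->
  {in F &, injective s} -> m <= #|V|%:R -> fail_prob p m s = 0.
Proof.
move=> tF colF injF mV; rewrite /fail_prob /gcnp_prob big_pred0 // => H.
apply/negP => /set_mem /=; apply; exists V, F; split=> //; split.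
  apply/fintype.subsetP => e /colF[k E].
  by rewrite finset.in_set /complete ffunE E.
move=> e e' eF e'F; have [k E] := colF _ eF; have [k' E'] := colF _ e'F.
by rewrite /complete !ffunE E E' /= => h; apply: injF => //; rewrite E E' h.
Qed.

(** * States of the exploration *)

(** The state of a search with answers [s]: [D] holds the vertices of the
    discarded trees and [(V, F)] is the current tree. The vertex [v] of [V] is
    being explored, and its pairs with [X] remain to be queried; [A] holds the
    vertices of [V] still to be explored afterwards. Thus
    [#|D| + #|V| - #|A|] vertices have been explored, counting [v]. Both [V] and
    [X] may be empty, which covers the start of the search; then [v] is
    arbitrary. *)
Record exploring (n c K : nat) (s : answers n c) (D V A X : {set 'I_n})
    (F : {set edge n}) (v : 'I_n) : Prop := Exploring {
  dead_disjoint : [disjoint D & V];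
  dead_few : (#|D| <= K)%N;
  current_tree : V != finset.set0 -> is_tree V F;
  card_edges_le : (#|F| <= #|V|)%N;
  edges_answered : {in F, forall e, exists k, s e = Some (Some k)};
  edges_rainbow : {in F &, injective s};
  active_in_tree : A \subset V;
  pending_unseen : X \subset (~: (D :|: V))%SET;
  explored_in_tree : X != finset.set0 -> v \in V;
  explored_inactive : v \notin A;
  fresh_pairs : forall (e : edge n) (x y : 'I_n), val e = [set x; y]%SET ->
    y \notin (D :|: V)%SET -> (x \in A) || (x \notin (D :|: V)%SET) -> s e = None;
  fresh_pending : forall (e : edge n) (y : 'I_n), y \in X ->
    val e = [set v; y]%SET -> s e = None
}.

Definition used_colours (n c : nat) (s : answers n c) (F : {set edge n}) :
    {set 'I_c} :=
  finset (fun k => Some (Some k) \in [seq s e | e in F]).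

Lemma card_used_colours (n c : nat) (s : answers n c) (F : {set edge n}) :
  (#|used_colours s F| <= #|F|)%N.
Proof.
have inj : injective (fun k : 'I_c => Some (Some k)) by move=> k k' [].
rewrite -(card_imset _ inj); apply: leq_trans (leq_imset_card s _).
apply: subset_leq_card; apply/fintype.subsetP => _ /imsetP[k + ->].
by rewrite finset.in_set => /mapP[e]; rewrite mem_enum => eF ->; exact: imset_f.
Qed.

(** The invariant survives because [e] contains [y], which is no longer unseen, so
    that the pairs required to be fresh do not include [e]. *)
Lemma exploring_grow (n c K : nat) (s : answers n c) (D V A X : {set 'I_n})
    (F : {set edge n}) (v y : 'I_n) (e : edge n) (k : 'I_c) :
  exploring K s D V A X F v -> y \in X -> val e = [set v; y]%SET ->
  k \notin used_colours s F ->
  exploring K (add_answer s e (Some k)) D (y |: V)%SET (y |: A)%SET (X :\ y)%SET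
    (e |: F)%SET v.
Proof.
move=> I yX ve kF; have X0 : X != finset.set0 by apply/set0Pn; exists y.
have vV := explored_in_tree I X0.
have V0 : V != finset.set0 by apply/set0Pn; exists v.
have := fintype.subsetP (pending_unseen I) _ yX.
rewrite !inE negb_or => /andP[yD yV].
have yv : y != v by apply: contraNneq yV => ->.
have se := fresh_pending I yX ve.
have eF : e \notin F by apply/negP => /(edges_answered I)[k']; rewrite se.
have sF e' : e' \in F -> add_answer s e (Some k) e' = s e'.
  by move=> e'F; rewrite /add_answer; case: eqP => // E; rewrite -E e'F in eF.
have newP e' : e' \in F -> s e' <> Some (Some k).
  move=> e'F E; move/negP: kF; apply; rewrite finset.in_set -E.
  by apply/mapP; exists e'; rewrite ?mem_enum.
have se_e : add_answer s e (Some k) e = Some (Some k) by rewrite /add_answer eqxx.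
split.
- have := dead_disjoint I; rewrite !finset.disjoints_subset finset.setCU.
  rewrite finset.subsetI => ->.
  by rewrite andbT finset.subsetC finset.sub1set finset.in_setC.
- exact: dead_few I.
- by move=> _; apply: is_tree_leaf (current_tree I V0) vV yV ve.
- by rewrite !cardsU1 eF yV leq_add2l (card_edges_le I).
- move=> e' /setU1P[->|e'F]; first by exists k.
  by rewrite sF //; exact: edges_answered I _ e'F.
- move=> e1 e2 /setU1P[->|e1F] /setU1P[->|e2F] //; rewrite ?se_e ?sF //.
  + by move/esym/newP => /(_ e2F).
  + by move/newP => /(_ e1F).
  + exact: edges_rainbow I _ _ e1F e2F.
- by rewrite finset.setUS // (active_in_tree I).
- apply/fintype.subsetP => x /setD1P[xy xX].
  have := fintype.subsetP (pending_unseen I) _ xX.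
  by rewrite !inE (negbTE xy).
- by move=> _; rewrite finset.in_setU vV orbT.
- by rewrite !inE negb_or eq_sym yv (explored_inactive I).
- move=> e' x y' ve'; rewrite !inE !negb_or => /and3P[y'D y'y y'V] hx.
  rewrite /add_answer; case: eqP => [E|_].
    have : y' \in val e by rewrite -E ve' finset.set22.
    by rewrite ve !inE (negbTE y'y) orbF => /eqP E'; rewrite E' vV in y'V.
  apply: (fresh_pairs I ve'); first by rewrite !inE negb_or y'D.
  rewrite !inE negb_or; case/orP: hx => [/orP[/eqP->|->]//|/and3P[-> _ ->]].
    by rewrite yD yV orbT.
  by rewrite orbT.
- move=> e' y' /setD1P[y'y y'X] ve'.
  rewrite /add_answer; case: eqP => [E|_]; last first.
    by have -> := fresh_pending I y'X ve'.
  have : y' \in val e by rewrite -E ve' finset.set22.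
  rewrite ve !inE (negbTE y'y) orbF => /eqP E'.
  have := fintype.subsetP (pending_unseen I) _ y'X.
  by rewrite !inE E' vV orbT.
Qed.

(** Here [y] stays unseen, but the other end of [e] is [v], which is in the tree and
    no longer active: again [e] is not among the pairs required to be fresh. *)
Lemma exploring_skip (n c K : nat) (s : answers n c) (D V A X : {set 'I_n})
    (F : {set edge n}) (v y : 'I_n) (e : edge n) (o : option 'I_c) :
  exploring K s D V A X F v -> y \in X -> val e = [set v; y]%SET ->
  exploring K (add_answer s e o) D V A (X :\ y)%SET F v.
Proof.
move=> I yX ve; have X0 : X != finset.set0 by apply/set0Pn; exists y.
have vV := explored_in_tree I X0.
have unseen x : x \in X -> x \notin (D :|: V)%SET.
  by move/(fintype.subsetP (pending_unseen I)); rewrite finset.in_setC.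
have se := fresh_pending I yX ve.
have eF : e \notin F by apply/negP => /(edges_answered I)[k']; rewrite se.
have sF e' : e' \in F -> add_answer s e o e' = s e'.
  by move=> e'F; rewrite /add_answer; case: eqP => // E; rewrite -E e'F in eF.
have neq_v x : x \notin (D :|: V)%SET -> x != v.
  by apply: contraNneq => ->; rewrite finset.in_setU vV orbT.
split.
- exact: dead_disjoint I.
- exact: dead_few I.
- exact: current_tree I.
- exact: card_edges_le I.
- by move=> e' e'F; rewrite sF //; exact: edges_answered I _ e'F.
- by move=> e1 e2 e1F e2F; rewrite !sF //; exact: edges_rainbow I _ _ e1F e2F.
- exact: active_in_tree I.
- by apply: fintype.subset_trans (pending_unseen I); exact: subD1set.
- by [].
- exact: explored_inactive I.
- move=> e' x y' ve' hy' hx; rewrite /add_answer; case: eqP => [E|_].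
    have : v \in val e' by rewrite E ve finset.set21.
    rewrite ve' !inE => /orP[/eqP Ex|/eqP Ey]; last first.
      by have := neq_v _ hy'; rewrite Ey eqxx.
    move: hx; rewrite -Ex (negbTE (explored_inactive I)) /=.
    by rewrite finset.in_setU vV orbT.
  by rewrite (fresh_pairs I ve' hy' hx).
- move=> e' y' /setD1P[y'y y'X] ve'.
  rewrite /add_answer; case: eqP => [E|_]; last first.
    by have -> := fresh_pending I y'X ve'.
  have : y' \in val e by rewrite -E ve' finset.set22.
  by rewrite ve !inE (negbTE y'y) (negbTE (neq_v _ (unseen _ y'X))).
Qed.

Lemma exploring_next (n c K : nat) (s : answers n c) (D V A : {set 'I_n})
    (F : {set edge n}) (v w : 'I_n) :
  exploring K s D V A finset.set0 F v -> w \in A ->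
  exploring K s D V (A :\ w)%SET (~: (D :|: V))%SET F w.
Proof.
move=> I wA; have wV := fintype.subsetP (active_in_tree I) _ wA.
case: (I) => h1 h2 h3 h4 h5 h6 h7 _ _ _ h10 _; split=> //.
- by apply: fintype.subset_trans h7; exact: subD1set.
- by rewrite setD11.
- move=> e x y ve hy hx; apply: h10 ve hy _.
  by case/orP: hx => [/setD1P[_ ->]//|->]; rewrite orbT.
- by move=> e y; rewrite finset.in_setC => hy ve; apply: h10 ve hy _; rewrite wA.
Qed.

(** Every queried pair has an end in some tree, so a search restarted at [r] among
    the unseen vertices meets only unqueried pairs. *)
Lemma exploring_restart (n c K : nat) (s : answers n c) (D V : {set 'I_n})
    (F : {set edge n}) (v r : 'I_n) :
  exploring K s D V finset.set0 finset.set0 F v -> (#|D :|: V| <= K)%N ->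
  r \notin (D :|: V)%SET ->
  exploring K s (D :|: V)%SET [set r]%SET finset.set0
    (~: (D :|: V :|: [set r]))%SET finset.set0 r.
Proof.
move=> I leK rU; have fresh := fresh_pairs I; split=> //.
- by rewrite disjoint_sym finset.disjoints1.
- by move=> _; exact: is_tree1.
- by rewrite cards0.
- by move=> e; rewrite finset.in_set0.
- by move=> e e'; rewrite finset.in_set0.
- exact: finset.sub0set.
- by move=> _; rewrite finset.set11.
- by rewrite finset.in_set0.
- move=> e x y ve hy hx; apply: (fresh _ _ _ ve).
    by apply: contra hy => hy; rewrite finset.in_setU hy.
  case/orP: hx => [|hx]; first by rewrite finset.in_set0.
  by apply/orP; right; apply: contra hx => hx; rewrite finset.in_setU hx.
- move=> e y; rewrite finset.in_setC => hy ve; apply: (fresh _ _ _ ve).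
    by apply: contra hy => hy; rewrite finset.in_setU hy.
  by rewrite rU orbT.
Qed.

(** * The supermartingale bound *)

(** One query multiplies the bound by [z] if it enlarges the tree. At most
    [#|F| <= m] of the [c] colours are used, so that this happens with probability
    at least [p (1 - m / c)]. *)
Lemma sum_pair_mass_fresh (R : realType) (n c : nat) (p q m z : R)
    (s : answers n c) (F : {set edge n}) :
  (0 < c)%N -> 0 <= p -> z <= 1 -> q <= p * (1 - m / c%:R) -> #|F|%:R <= m ->
  \sum_o pair_mass p o *
     (if o is Some k then if k \in used_colours s F then 1 else z else 1)
    <= 1 - q * (1 - z).
Proof.
move=> c0 p0 z1 hq Fm; have c0' : 0 < c%:R :> R by rewrite ltr0n.
rewrite sum_option /= mulr1 -mulr_sumr.
set a := used_colours s F.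
have -> : \sum_(k < c) (if k \in a then 1 else z) = #|a|%:R + (c%:R - #|a|%:R) * z.
  rewrite (bigID (mem a)) /= (eq_bigr (fun=> 1)) => [|k ->//].
  rewrite [X in _ + X](eq_bigr (fun=> z)) => [|k /negPf->//].
  rewrite !sumr_const -[z *+ _]mulr_natl; congr (_ + _ * _).
  by apply/eqP; rewrite eq_sym subr_eq addrC -natrD cardC card_ord.
have aF : #|a|%:R <= #|F|%:R :> R by rewrite ler_nat card_used_colours.
have E x : p / c%:R * (x + (c%:R - x) * z) = p - p * (1 - x / c%:R) * (1 - z).
  by field; rewrite gt_eqF.
rewrite E; suff: q <= p * (1 - #|a|%:R / c%:R) by nra.
apply: le_trans hq _; rewrite ler_wpM2l // lerB // ler_pM2r ?invr_gt0 //.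
exact: le_trans aF Fm.
Qed.

(** Lexicographic descent: exploring one more vertex outweighs any new number [x]
    of pending pairs. *)
Lemma measure_drop (n k a x N : nat) : (k < n)%N -> (x <= n)%N ->
  ((n - k) * n.+1 + a <= N)%N -> ((n - k.+1) * n.+1 + x < N)%N.
Proof.
move=> kn xn; apply: leq_trans; by rewrite -[in leqRHS](subnSK kn) mulSn; lia.
Qed.

(** The bound is a supermartingale for the exploration. A query multiplies its
    expectation by at most 1, by [sum_pair_mass_fresh]. Passing to the next vertex
    loses a factor [rho * z] but opens the pairs with all unseen vertices; before
    success there are at least [n - K - m] of these, since [#|D| <= K] and
    [#|V| < m]. A restart takes no vertex out of [A] and only happens when fewer
    than [K] vertices have been explored, all of which are then dead. If the tree
    dies later, the bound is 1. *)
Lemma explore_fail_prob (R : realType) (n c K : nat) (p q m z rho : R) :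
  (0 < c)%N -> 0 <= p -> p <= 1 -> 0 <= q -> q <= p * (1 - m / c%:R) ->
  0 < m -> 0 <= z -> z <= 1 -> 0 <= rho -> rho <= 1 -> (K <= n)%N ->
  (forall x : nat, n%:R - K%:R - m <= x%:R ->
     (1 - q * (1 - z)) ^+ x <= rho * z) ->
  forall (s : answers n c) (D V A X : {set 'I_n}) (F : {set edge n}) (v : 'I_n),
  exploring K s D V A X F v ->
  fail_prob p m s <=
    z ^+ #|A| * rho ^+ (K - (#|D| + #|V| - #|A|)) * (1 - q * (1 - z)) ^+ #|X|.
Proof.
move=> c0 p0 p1 q0 hq m0 z0 z1 rho0 rho1 Kn hx.
have c0' : 0 < c%:R :> R by rewrite ltr0n.
set theta := 1 - q * (1 - z) in hx *.
have qp : q <= p.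
  apply: le_trans hq _; rewrite ler_piMr // gerBl divr_ge0 ?ltW //.
have theta0 : 0 <= theta by rewrite /theta; nra.
have next k x : n%:R - K%:R - m <= x%:R ->
    rho ^+ (K - k.+1) * theta ^+ x <= z * rho ^+ (K - k).
  move=> /hx h; apply: (@le_trans _ _ (rho ^+ (K - k.+1) * (rho * z))).
    by rewrite ler_wpM2l // exprn_ge0.
  by rewrite mulrA mulrC ler_wpM2l // -exprSr ler_wiXn2l // subnS leqSpred.
move=> s D V A X F v I.
have [N] := ubnP ((n - (#|D| + #|V| - #|A|)) * n.+1 + #|X|)%N.
elim: N => // N IH in s D V A X F v I *; rewrite ltnS => leN.
have cardVA : (#|A| <= #|V|)%N by apply: subset_leq_card (active_in_tree I).
have cardn (B : {set 'I_n}) : (#|B| <= n)%N by rewrite -[leqRHS]card_ord max_card.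
have cardDV : #|D :|: V|%SET = (#|D| + #|V|)%N.
  by have := leq_card_setU D V; rewrite (dead_disjoint I) => /leqifP/eqP.
have leDV : (#|D| + #|V| <= n)%N by rewrite -cardDV.
have cardU : #|~: (D :|: V)|%SET = (n - (#|D| + #|V|))%N.
  apply/eqP; rewrite -(eqn_add2l (#|D| + #|V|)) subnKC // -{1}cardDV cardsC.
  by rewrite card_ord.
have bound0 j k x : 0 <= z ^+ j * rho ^+ k * theta ^+ x.
  by rewrite !mulr_ge0 ?exprn_ge0.
have [mV|Vm] := lerP m #|V|%:R.
  have V0 : V != finset.set0.
    by apply: contraTneq mV => ->; rewrite cards0 -ltNge.
  rewrite (fail_prob_found p (current_tree I V0) (edges_answered I)
    (edges_rainbow I) mV).
  exact: bound0.
have [X0|[y yX]] := set_0Vmem X.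
  rewrite X0 cards0 expr0 mulr1 in leN *; rewrite X0 in I.
  have [A0|[w wA]] := set_0Vmem A.
    rewrite A0 cards0 expr0 mul1r subn0 in leN *; rewrite A0 in I.
    (* The tree is dead: the bound is 1, unless a restart is still allowed. *)
    have [leK|ltK] := leqP K (#|D| + #|V|)%N.
      move: leK; rewrite -subn_eq0 => /eqP->; rewrite expr0.
      exact: gcnp_prob_le1.
    have [r] : exists r, r \in (~: (D :|: V))%SET.
      by apply/card_gt0P; rewrite cardU subn_gt0; exact: leq_trans ltK Kn.
    rewrite finset.in_setC => rU.
    have ltK' : (#|D :|: V|%SET < K)%N by rewrite cardDV.
    have I' := exploring_restart I (ltnW ltK') rU.
    apply: le_trans (IH _ _ _ _ _ _ _ I' _) _.
      rewrite cards0 subn0 cards1 cardDV addn1.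
      exact: measure_drop (leq_trans ltK Kn) (cardn _) leN.
    rewrite cards0 expr0 mul1r subn0 cards1 cardDV addn1.
    apply: le_trans (next _ _ _) _; last by rewrite ler_piMl ?exprn_ge0.
    have : (n <= #|~: (D :|: V :|: [set r])|%SET + K)%N.
      rewrite -[leqLHS]card_ord -[leqLHS](cardsC (D :|: V :|: [set r])%SET).
      rewrite addnC leq_add2l; apply: leq_trans ltK'.
      have := leq_card_setU (D :|: V)%SET [set r]%SET.
      by rewrite cards1 addn1 => -[].
    by rewrite -(ler_nat R) natrD; lra.
  have I' := exploring_next I wA.
  have cardA : #|A| = #|(A :\ w)%SET|.+1 by rewrite (cardsD1 w) wA.
  have ltk : (#|D| + #|V| - #|A| < n)%N.
    apply: leq_trans leDV; rewrite ltn_subrL [in X in X && _]cardA /=.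
    by apply: leq_trans (leq_addl _ _); apply: leq_trans cardVA; rewrite cardA.
  have Ek : (#|D| + #|V| - #|(A :\ w)%SET| = (#|D| + #|V| - #|A|).+1)%N.
    by rewrite cardA subnSK // -cardA; exact: leq_trans cardVA (leq_addl _ _).
  apply: le_trans (IH _ _ _ _ _ _ _ I' _) _; rewrite Ek.
    exact: measure_drop ltk (cardn _) leN.
  rewrite cardA exprSr -!mulrA ler_wpM2l ?exprn_ge0 //; apply: next.
  have : (n <= #|~: (D :|: V)|%SET + (#|D| + #|V|))%N by rewrite cardU subnK.
  have := dead_few I; rewrite -!(ler_nat R) !natrD; lra.
have X0 : X != finset.set0 by apply/set0Pn; exists y.
have vV := explored_in_tree I X0.
have vy : v != y.
  have := fintype.subsetP (pending_unseen I) _ yX.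
  by apply: contraTneq => <-; rewrite finset.in_setC finset.in_setU vV orbT.
have [e ve] := edge_of_pair vy.
rewrite (fail_prob_query p m c0 (fresh_pending I yX ve)).
have cardX : #|X| = #|(X :\ y)%SET|.+1 by rewrite (cardsD1 y) yX.
set B := z ^+ #|A| * rho ^+ (K - (#|D| + #|V| - #|A|)) * theta ^+ #|(X :\ y)%SET|.
rewrite cardX exprSr mulrA -/B mulrC.
have B0 : 0 <= B by exact: bound0.
have fresh := sum_pair_mass_fresh s c0 p0 z1 hq (F := F).
apply: le_trans (ler_wpM2r B0 (fresh _)); last first.
  by apply: le_trans (ltW Vm); rewrite ler_nat (card_edges_le I).
rewrite mulr_suml; apply: ler_sum => o _; rewrite -mulrA ler_wpM2l ?pair_mass_ge0 //.
have skip : fail_prob p m (add_answer s e o) <= B.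
  apply: (IH _ _ _ _ _ _ _ (exploring_skip o I yX ve)).
  by move: leN; rewrite cardX addnS.
case: o skip => [k|]; last by rewrite mul1r.
case: ifP => [_|/negbT kF]; first by rewrite mul1r.
move=> _; have yV : y \notin V.
  have := fintype.subsetP (pending_unseen I) _ yX.
  by rewrite finset.in_setC finset.in_setU negb_or => /andP[].
have yA : y \notin A.
  by apply: contra yV; exact: fintype.subsetP (active_in_tree I) _.
have cA : #|(y |: A)%SET| = #|A|.+1 by rewrite cardsU1 yA.
have cV : #|(y |: V)%SET| = #|V|.+1 by rewrite cardsU1 yV.
apply: le_trans (IH _ _ _ _ _ _ _ (exploring_grow I yX ve kF) _) _.
  by rewrite cA cV addnS subSS; move: leN; rewrite cardX addnS.
by rewrite cA cV addnS subSS exprS /B !mulrA.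
Qed.

Lemma fail_prob_le (R : realType) (n c K : nat) (p q m z rho : R) :
  (0 < n)%N -> (0 < c)%N -> 0 <= p -> p <= 1 -> 0 <= q ->
  q <= p * (1 - m / c%:R) -> 0 < m -> 0 <= z -> z <= 1 -> 0 <= rho -> rho <= 1 ->
  (K <= n)%N ->
  (forall x : nat, n%:R - K%:R - m <= x%:R ->
     (1 - q * (1 - z)) ^+ x <= rho * z) ->
  gcnp_prob p [set H : cgraph n c | ~ has_rainbow_tree m H]%classic <= rho ^+ K.
Proof.
case: n => // n _ c0 p0 p1 q0 hq m0 z0 z1 rho0 rho1 Kn hx.
have I : exploring K (@no_answers n.+1 c) finset.set0 finset.set0 finset.set0
    finset.set0 finset.set0 ord0.
  split; rewrite ?cards0 ?eqxx ?finset.sub0set ?finset.in_set0 //.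
  - by rewrite finset.disjoints_subset finset.sub0set.
  - by move=> e; rewrite finset.in_set0.
  - by move=> e e'; rewrite finset.in_set0.
have := explore_fail_prob c0 p0 p1 q0 hq m0 z0 z1 rho0 rho1 Kn hx I.
rewrite !cards0 !expr0 mul1r mulr1 addn0 !subn0.
have -> : fail_prob p m (@no_answers n.+1 c) =
  gcnp_prob p [set H : cgraph n.+1 c | ~ has_rainbow_tree m H]%classic.
  congr (gcnp_prob _ _); apply/funext => H /=; congr (~ has_rainbow_tree _ _).
  by apply/ffunP => e; rewrite ffunE.
by [].
Qed.

(** * Estimates of the mean offspring *)

(** Bernoulli's inequality, in the form that bounds [(1 - y) ^ x] from above
    without exponentials. *)
Lemma expr_bernoulli_le (R : realType) (y : R) (x : nat) :
  0 <= y -> y <= 1 -> (1 - y) ^+ x * (1 + x%:R * y) <= 1.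
Proof.
move=> y0 y1; elim: x => [|x IH]; first by rewrite expr0 mul0r addr0 mulr1.
apply: le_trans IH; rewrite exprSr -mulrA ler_wpM2l ?exprn_ge0 ?subr_ge0 //.
rewrite -natr1; have : 0 <= x%:R :> R by []; nra.
Qed.

(** This bounds the generating function, at [1 - u], of a binomial number of
    children with mean at least [mu]. *)
Lemma survival_rate (R : realType) (mu q N u : R) (x : nat) :
  0 <= q -> q <= 1 -> 0 <= u -> u <= 1 -> 0 <= mu -> mu <= q * N -> N <= x%:R ->
  (1 - q * u) ^+ x <= (1 + mu * u)^-1.
Proof.
move=> q0 q1 u0 u1 mu0 hmu Nx.
have hqx : mu * u <= x%:R * (q * u).
  by rewrite mulrA ler_wpM2r // mulrC (le_trans hmu) // ler_wpM2l.
have muu : 0 <= mu * u by rewrite mulr_ge0.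
have qu0 : 0 <= q * u by rewrite mulr_ge0.
have qu1 : q * u <= 1 by rewrite mulr_ile1.
have := expr_bernoulli_le x qu0 qu1.
have d0 : 0 < 1 + x%:R * (q * u) by lra.
rewrite -ler_pdivlMr // div1r => /le_trans; apply.
by rewrite lef_pV2 ?posrE ?lerD2l //; lra.
Qed.

(** The constant [alpha / (alpha + 1)] comes from
      tau / alpha + tau = tau (alpha + 1) / alpha
                        = eps - 2 eps^2 (alpha + 1) / alpha,
    the relative loss of colours plus that of vertices when the tree has [tau n]
    vertices. The gain [2 eps^2] exceeds the loss [eps^2] in
    [(1 + eps) (1 - eps)] and leaves room for the rounding of [c] and for the [K]
    discarded vertices. *)
Lemma offspring_mean (R : realType) (alpha eps n c K : R) :
  0 < alpha -> 0 < eps -> eps < alpha / (alpha + 1) / 2 -> 0 < n ->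
  alpha * n - 1 < c -> K <= eps ^+ 2 / 8 * n -> 8 <= eps ^+ 2 * alpha * n ->
  let tau := alpha / (alpha + 1) * eps - 2 * eps ^+ 2 in
  1 + eps ^+ 2 / 2 <= (1 + eps) / n * (1 - tau * n / c) * (n - K - tau * n).
Proof.
move=> al0 e0; set a := alpha / (alpha + 1) => ea n0 hc hK hn; cbv zeta.
set tau := a * eps - 2 * eps ^+ 2.
have al1 : 0 < alpha + 1 by lra.
have a1 : a < 1 by rewrite /a ltr_pdivrMr; lra.
have aE : a * (alpha + 1) = alpha by rewrite /a; field; rewrite gt_eqF.
have e1 : eps < 1 / 2 by lra.
have tau0 : 0 < tau by rewrite /tau; nra.
have an8 : 8 <= alpha * n by nra.
have c0 : 0 < c by lra.
pose t := tau / alpha.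
have tE : tau = t * alpha by rewrite /t; field; rewrite gt_eqF.
have t0 : 0 < t by rewrite divr_gt0.
have sumE : t + tau <= eps - 2 * eps ^+ 2.
  have h : alpha * (t + tau) = (alpha + 1) * tau.
    by rewrite mulrDr [alpha * t]mulrC -tE; ring.
  have h2 : (alpha + 1) * tau = alpha * eps - 2 * eps ^+ 2 * (alpha + 1).
    by rewrite /tau mulrBr mulrA [_ * a]mulrC aE; ring.
  by rewrite -(ler_pM2l al0) h h2; nra.
set x := tau * n / c; set y := (K + tau * n) / n.
have -> : (1 + eps) / n * (1 - x) * (n - K - tau * n) =
          (1 + eps) * ((1 - x) * (1 - y)).
  by rewrite /y; field; rewrite gt_eqF.
have hx : x <= t + eps ^+ 2 / 8.
  rewrite /x ler_pdivrMr //.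
  have : (t + eps ^+ 2 / 8) * (alpha * n - 1) <= (t + eps ^+ 2 / 8) * c.
    by rewrite ler_wpM2l; nra.
  apply: le_trans; rewrite tE; nra.
have hy : y <= tau + eps ^+ 2 / 8 by rewrite /y ler_pdivrMr //; lra.
have hxy : 1 - eps + 7 / 4 * eps ^+ 2 <= (1 - x) * (1 - y).
  apply: (@le_trans _ _ ((1 - (t + eps ^+ 2 / 8)) * (1 - (tau + eps ^+ 2 / 8)))).
    nra.
  by apply: ler_pM; nra.
nra.
Qed.

(** * Rainbow trees of linear order *)

Local Open Scope classical_set_scope.

Theorem theorem1p4 (R : realType) (alpha : R) (alpha_gt0 : 0 < alpha) :
  exists eps0 C : R, [/\ 0 < eps0, 0 < C &
    forall eps : R, 0 < eps -> eps < eps0 ->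
    forall c : nat -> nat,
      (forall n : nat, `|(c n)%:R - alpha * n%:R| < 1) ->
      gcnp_prob ((1 + eps) / n%:R)
        [set H : cgraph n (c n) |
          has_rainbow_tree
            ((alpha / (alpha + 1) * eps - C * eps ^+ 2) * n%:R) H]
        @[n --> \oo] --> (1 : R)].
Proof.
have al1 : 0 < alpha + 1 by lra.
(* This choice of eps0 makes the target size tau * n positive. *)
exists (alpha / (alpha + 1) / 2), 2; split=> //.
  by rewrite !divr_gt0.
move=> eps eps_gt0 eps_lt c hc.
set a := alpha / (alpha + 1) in eps_lt *.
have a1 : a < 1 by rewrite /a ltr_pdivrMr; lra.
set tau := a * eps - 2 * eps ^+ 2.
have tau0 : 0 < tau by rewrite /tau; nra.
pose delta := eps ^+ 2 / 2.
have delta0 : 0 < delta by rewrite /delta; nra.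
(* This u maximizes (1 + (1 + delta) * u) * (1 - u), which must exceed 1. *)
pose u := delta / (2 * (1 + delta)).
have uE : u * (1 + delta) = delta / 2 by rewrite /u; field; lra.
have u0 : 0 < u by rewrite divr_gt0 //; lra.
have u1 : u <= 1 / 2 by rewrite /u ler_pdivrMr; lra.
pose rho := ((1 + (1 + delta) * u) * (1 - u))^-1.
have growth : 1 < (1 + (1 + delta) * u) * (1 - u) by nra.
have rho0 : 0 <= rho by rewrite invr_ge0; lra.
have rho1 : rho < 1 by rewrite invf_lt1 //; lra.
(* K = n %/ M is then at most eps ^+ 2 / 8 * n. *)
pose M := (Num.truncn (8 / eps ^+ 2)).+1.
have hM : 8 / eps ^+ 2 < M%:R by exact: truncnS_gt.
have e2 : 0 < eps ^+ 2 by rewrite exprn_gt0.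
have fail_small : \forall n \near \oo,
    1 - rho ^+ (n %/ M) <= gcnp_prob ((1 + eps) / n%:R)
        [set H : cgraph n (c n) | has_rainbow_tree (tau * n%:R) H] <= 1.
  near=> n.
  have n2 : 2 <= n%:R :> R by near: n; exact: nbhs_infty_ger.
  have n0 : 0 < n%:R :> R by lra.
  have nbig : 8 / (eps ^+ 2 * alpha) <= n%:R by near: n; exact: nbhs_infty_ger.
  have hn : 8 <= eps ^+ 2 * alpha * n%:R.
    by move: nbig; rewrite ler_pdivrMr ?mulr_gt0 // mulrC.
  have cn : alpha * n%:R - 1 < (c n)%:R.
    by have := hc n; rewrite ltr_norml => /andP[]; lra.
  have an8 : 8 <= alpha * n%:R by nra.
  have c0 : 0 < (c n)%:R :> R by lra.
  have cN0 : (0 < c n)%N by rewrite -(ltr0n R).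
  set p := (1 + eps) / n%:R.
  have p0 : 0 <= p by rewrite divr_ge0; lra.
  have p1 : p <= 1 by rewrite /p ler_pdivrMr //; lra.
  rewrite gcnp_prob_le1 // andbT gcnp_prob_setC // lerB //.
  have hK : (n %/ M)%:R <= eps ^+ 2 / 8 * n%:R :> R.
    have : (n %/ M)%:R * M%:R <= n%:R :> R by rewrite -natrM ler_nat leq_trunc_div.
    move: hM; rewrite ltr_pdivrMr // => hM; have : 0 <= (n %/ M)%:R :> R by []; nra.
  have mean := offspring_mean alpha_gt0 eps_gt0 eps_lt n0 cn hK hn.
  rewrite -/a -/tau -/delta -/p in mean.
  set m := tau * n%:R in mean *.
  have m0 : 0 < m by rewrite mulr_gt0.
  have a_le : a <= alpha by rewrite /a ler_pdivrMr //; nra.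
  have tau_le : tau <= alpha / 2 by rewrite /tau; nra.
  have mc : m / (c n)%:R <= 1 by rewrite ler_pdivrMr // mul1r /m; nra.
  have mc0 : 0 <= m / (c n)%:R by rewrite divr_ge0 // ltW.
  have q0 : 0 <= p * (1 - m / (c n)%:R) by rewrite mulr_ge0 // subr_ge0.
  have q1 : p * (1 - m / (c n)%:R) <= 1 by rewrite mulr_ile1 //; lra.
  apply: (fail_prob_le (q := p * (1 - m / (c n)%:R)) (z := 1 - u)) => //.
  - by rewrite -(ltr0n R).
  - by lra.
  - by lra.
  - exact: ltW.
  - exact: leq_div.
  - move=> x hx; rewrite opprB addrCA subrr addr0.
    have -> : rho * (1 - u) = (1 + (1 + delta) * u)^-1.
      by rewrite /rho; field; apply/andP; split; rewrite gt_eqF //; nra.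
    by apply: survival_rate mean hx => //; lra.
apply: (squeeze_cvgr fail_small); last exact: cvg_cst.
rewrite -[X in _ --> X]subr0; apply: cvgB; first exact: cvg_cst.
apply: (@cvg_comp _ _ _ (fun n => n %/ M)%N (GRing.exp rho) _ \oo).
  apply/cvgnyPge => A; near=> n.
  have : (A * M <= n)%N by near: n; exact: nbhs_infty_ge.
  by rewrite leq_divRL.
by apply: cvg_expr; rewrite ger0_norm.
Unshelve. all: by end_near.
Qed.
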